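(* Let $\Omega\subset\mathbb{C}$ contain no poles of $\widehat{H}$. For each $s\in\Omega$ there exists a constant $C_s>0$, which may depend on $s$ (but not on $\sigma$), such that, for every $\sigma\in\mathbb{R}$ with $$0<\sigma<\frac{1}{\kappa_2(s\widehat{E}-\widehat{A})}\min\left\{\frac{\|s\widehat{E}-\widehat{A}\|_2}{4\sqrt{n}\,(\|F_E\|_2+\|F_A\|_2)},\ \frac{\|\widehat{B}\|_2}{4\sqrt{n}\,\|\widehat{B}\|_\infty}\right\},$$ the bound $$|\widetilde{H}(s)-\widehat{H}(s)|\le C_s\,\sigma$$ holds with probability at least $1-4\exp(-n/2)$.
   Context: Full system: let $N\in\mathbb{N}$, $E,A\in\mathbb{R}^{N\times N}$, $B\in\mathbb{R}^{N\times 1}$, $C\in\mathbb{R}^{1\times N}$ with $E$ of full rank, and let $H(s)=C(sE-A)^{-1}B$ be its transfer function. Loewner model: let $n\in\mathbb{N}$ and let $2n$ interpolation points in $\mathbb{C}$ be partitioned into $\{\mu_1,\dots,\mu_n\}$ and $\{\gamma_1,\dots,\gamma_n\}$, with $\mu_i\neq\gamma_j$ for all $i,j$ and with $H$ defined at all of these points. Define $n\times n$ matrices $$L_{ij}=\frac{H(\mu_i)-H(\gamma_j)}{\mu_i-\gamma_j},\qquad L^{(s)}_{ij}=\frac{\mu_iH(\mu_i)-\gamma_jH(\gamma_j)}{\mu_i-\gamma_j},$$ where the superscript $(s)$ is just notation (''shifted''). Let $\widehat{E}=-L$, $\widehat{A}=-L^{(s)}$, and let $\widehat{B}\in\mathbb{C}^{n\times1}$,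 $\widehat{C}\in\mathbb{C}^{1\times n}$ have entries $\widehat{B}_i=H(\mu_i)$, $\widehat{C}_i=H(\gamma_i)$; assume $\widehat{B}\ne 0$. Set $\widehat{H}(s)=\widehat{C}(s\widehat{E}-\widehat{A})^{-1}\widehat{B}$. A pole of $\widehat{H}$ means a point $s\in\mathbb{C}$ at which $s\widehat{E}-\widehat{A}$ is singular. Noise: $\mathcal{CN}(0,1)$ denotes the law of a complex random variable whose real and imaginary parts are independent real normal variables with mean $0$ and standard deviation $1$. Let $\epsilon_1,\dots,\epsilon_n,\eta_1,\dots,\eta_n$ be independent with law $\mathcal{CN}(0,1)$. For $\sigma>0$ put $H_\sigma(\mu_i)=H(\mu_i)(1+\sigma\epsilon_i)$ and $H_\sigma(\gamma_i)=H(\gamma_i)(1+\sigma\eta_i)$. The noisy Loewner model is defined by $$\widetilde{E}_{ij}=-\frac{H_\sigma(\mu_i)-H_\sigma(\gamma_j)}{\mu_i-\gamma_j},\quad \widetilde{A}_{ij}=-\frac{\mu_iH_\sigma(\mu_i)-\gamma_jH_\sigma(\gamma_j)}{\mu_i-\gamma_j},\quad \widetilde{B}_i=H_\sigma(\mu_i),\quad \widetilde{C}_i=H_\sigma(\gamma_i),$$ with transfer function $\widetilde{H}(s)=\widetilde{C}(s\widetilde{E}-\widetilde{A})^{-1}\widetilde{B}$. An event involving $\widetilde H(s)$ is understood to include that $s\widetilde E-\widetilde A$ is nonsingular. For $s\in\mathbb{C}$ the $n\times n$ matrices $F_E,F_A$ (depending on $s$) have entries $$(F_E)_{ij}=H(\mu_i)\frac{s-\mu_i}{\gamma_j-\mu_i},\qquad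 (F_A)_{ij}=H(\gamma_j)\frac{\gamma_j-s}{\gamma_j-\mu_i}.$$ $\|\cdot\|_2$ is the spectral norm for matrices and the Euclidean norm for vectors, $\|\cdot\|_\infty$ is the maximum modulus of the entries of a vector, and $\kappa_2(M)=\|M\|_2\|M^{-1}\|_2$. *)

(* Defs.v *)
From HB Require Import structures.
From mathcomp Require Import all_boot all_order all_algebra.
From mathcomp Require Import all_classical all_reals all_analysis.
From mathcomp Require Import complex.

Set Implicit Arguments.
Unset Strict Implicit.
Unset Printing Implicit Defensive.

Import Order.TTheory GRing.Theory Num.Theory.

Local Open Scope classical_set_scope.
Local Open Scope ring_scope.
Local Open Scope complex_scope.

Section norms.
Variable R : realType.

Definition vnorm2 n (x : 'cV[R[i]]_n) : R :=
  Num.sqrt (\sum_(i < n) ComplexField.Normc.normc (x i 0) ^+ 2).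

Definition vnorm_inf n (x : 'cV[R[i]]_n) : R :=
  \big[Num.max/0]_(i < n) ComplexField.Normc.normc (x i 0).

(* Spectral norm, as the operator norm induced by the Euclidean norm. *)
Definition mnorm2 m n (M : 'M[R[i]]_(m, n)) : R :=
  sup [set vnorm2 (M *m x) | x in [set x : 'cV[R[i]]_n | vnorm2 x <= 1]].

(* Only meaningful for invertible M: invmx M = M when M is singular. *)
Definition cond2 n (M : 'M[R[i]]_n) : R := mnorm2 M * mnorm2 (invmx M).

End norms.

Section models.
Variable K : fieldType.

(* Only meaningful at points s that are not poles of (E, A). *)
Definition transfer n (E A : 'M[K]_n) (B : 'cV[K]_n) (C : 'rV[K]_n) (s : K) : K :=
  (C *m invmx (s *: E - A) *m B) 0 0.

Definition pole n (E A : 'M[K]_n) (s : K) : bool :=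
  (s *: E - A) \notin unitmx.

Variable n : nat.
(* hmu i and hgam j are the transfer function values at mu i and gam j. *)
Variables mu gam hmu hgam : 'I_n -> K.

Definition loewner : 'M[K]_n :=
  \matrix_(i, j) ((hmu i - hgam j) / (mu i - gam j)).

Definition shifted_loewner : 'M[K]_n :=
  \matrix_(i, j) ((mu i * hmu i - gam j * hgam j) / (mu i - gam j)).

Definition loewner_E : 'M[K]_n := - loewner.
Definition loewner_A : 'M[K]_n := - shifted_loewner.
Definition loewner_B : 'cV[K]_n := \col_i hmu i.
Definition loewner_C : 'rV[K]_n := \row_j hgam j.

Definition loewner_transfer (s : K) : K :=
  transfer loewner_E loewner_A loewner_B loewner_C s.

Definition F_E (s : K) : 'M[K]_n :=
  \matrix_(i, j) (hmu i * ((s - mu i) / (gam j - mu i))).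

Definition F_A (s : K) : 'M[K]_n :=
  \matrix_(i, j) (hgam j * ((gam j - s) / (gam j - mu i))).

End models.

Definition real_transfer (R : realType) N (E A : 'M[R]_N) (B : 'cV[R]_N)
    (C : 'rV[R]_N) (s : R[i]) : R[i] :=
  transfer (map_mx (real_complex R) E) (map_mx (real_complex R) A)
    (map_mx (real_complex R) B) (map_mx (real_complex R) C) s.

Definition real_pole (R : realType) N (E A : 'M[R]_N) (s : R[i]) : bool :=
  pole (map_mx (real_complex R) E) (map_mx (real_complex R) A) s.

Definition noisy (R : realType) n (h : 'I_n -> R[i]) (sigma : R)
    (e : 'I_n -> R[i]) (i : 'I_n) : R[i] :=
  h i * (1 + sigma%:C * e i).

Section randomness.
Context d (T : measurableType d) (R : realType) (P : probability T R).

Definition mutually_independent d' (S : measurableType d') (I : finType)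
    (X : I -> T -> S) : Prop :=
  forall (J : {set I}) (A : I -> set S), (forall i, measurable (A i)) ->
    P [set t | forall i, i \in J -> A i (X i t)] =
    (\prod_(i in J) P (X i @^-1` A i))%E.

(* R[i] carries no measurable structure in the library; its Borel sigma-algebra
   is the one transported from R * R along z |-> (Re z, Im z). *)
Definition re_im (z : R[i]) : R * R := (complex.Re z, complex.Im z).

(* Real and imaginary parts both have standard deviation 1, so the variance of
   |Z| is not normalised to 1: E[|Z|^2] = 2. *)
Definition complex_std_normal (Z : T -> R[i]) : Prop :=
  let X := fun t => complex.Re (Z t) in
  let Y := fun t => complex.Im (Z t) in
  [/\ measurable_fun setT X, measurable_fun setT Y,
      mutually_independent (fun (b : bool) => if b then X else Y),
      (forall A, measurable A -> P (X @^-1` A) = normal_prob 0 1 A) &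
      (forall A, measurable A -> P (Y @^-1` A) = normal_prob 0 1 A)].

Definition complex_independent (I : finType) (Z : I -> T -> R[i]) : Prop :=
  mutually_independent (fun k t => re_im (Z k t)).

End randomness.

(* Main.v *)
Require Import Defs.
From HB Require Import structures.
From mathcomp Require Import all_boot all_order all_algebra.
From mathcomp Require Import all_classical all_reals all_analysis.
From mathcomp Require Import measurable_realfun.
From mathcomp Require Import complex.
From mathcomp Require Import ring lra.

Set Implicit Arguments.
Unset Strict Implicit.
Unset Printing Implicit Defensive.

Import Order.TTheory GRing.Theory Num.Theory.

Local Open Scope classical_set_scope.
Local Open Scope ring_scope.
Local Open Scope complex_scope.

(** Let [K = s hE - hA].  The entries of a Loewner pencil are affine in the
    sampled values, and a partial fraction computation shows that multiplicative
    noise turns [K] into [K + D] with [D = D_eps F_E + F_A D_eta], where [D_eps]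
    and [D_eta] are diagonal and carry [sigma eps_i] and [sigma eta_j]
    ([loewner_pencil_noise]).  Likewise the input becomes [hB + D_eps hB] and
    the output row becomes [hC + hC D_eta].

    Suppose that every noise variable has modulus at most [r = 3 sqrt n].  Then
    [|D| <= sigma r (|F_E| + |F_A|)], and the upper bound on [sigma], which
    contains [4 sqrt n] where the noise needs only [3 sqrt n], gives
    [|K^-1| |D| <= 3/4] ([threshold_gap]).  Hence [K + D] is invertible and its
    inverse has norm at most [4 |K^-1|], uniformly in [sigma]
    ([perturbed_lower_bound], [perturbed_unitmx]).  Comparing the solutions of
    [(K + D) x' = b'] and [K x = b] bounds the change of the transfer function
    by [sigma] times a quantity in which [sigma] occurs only through
    [1 + sigma r] ([noisy_loewner_transfer]); there [sigma] is replaced by the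
    threshold, which makes the constant independent of [sigma].

    It remains to bound the probability of a large noise variable.  If one of
    them exceeds [r] in modulus, one of the [4 n] real and imaginary parts
    exceeds [r / sqrt 2], and a standard normal variable exceeds [a] in absolute
    value with probability at most [2 exp (- a^2 / 2)].  The union bound gives
    [8 n exp (- 9 n / 4)], which is at most [4 exp (- n / 2)]
    ([small_noise_probability], [gaussian_tail_budget]).

    Passing from the event that the noise is small to the event that the error
    is small uses monotonicity of [P], hence measurability of the latter event;
    Cramer's rule reduces it to inequalities between polynomials in the noise
    ([measurable_transfer_close]). *)

Local Notation cnorm := ComplexField.Normc.normc.

(** * Euclidean and spectral norms *)

Section complex_norms.
Variable R : realType.
Implicit Types z : R[i].

Lemma cnorm_ge0 z : 0 <= cnorm z.
Proof. by case: z => a b; exact: sqrtr_ge0. Qed.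

Lemma cauchy_schwarz_sum n (a b : 'I_n -> R) :
  (\sum_i a i * b i) ^+ 2 <= (\sum_i a i ^+ 2) * (\sum_i b i ^+ 2).
Proof.
set A := \sum_i a i ^+ 2; set B := \sum_i b i ^+ 2; set C := \sum_i _.
have B0 : 0 <= B by apply: sumr_ge0 => i _; exact: sqr_ge0.
have [B0'|Bn0] := eqVneq B 0.
  suff -> : C = 0 by rewrite B0' expr0n mulr0.
  apply: big1 => i _.
  have/eqP : b i ^+ 2 = 0.
    by apply: (psumr_eq0P _ B0') => // j _; exact: sqr_ge0.
  by rewrite sqrf_eq0 => /eqP->; rewrite mulr0.
have Bgt0 : 0 < B by rewrite lt_def Bn0.
(* Up to the factor [B], this sum of squares is the defect [A * B - C ^+ 2]. *)
have : 0 <= \sum_i (B * a i - C * b i) ^+ 2.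
  by apply: sumr_ge0 => i _; exact: sqr_ge0.
have -> : \sum_i (B * a i - C * b i) ^+ 2 = B * (A * B - C ^+ 2).
  transitivity (\sum_i (B ^+ 2 * a i ^+ 2 - 2 * B * C * (a i * b i) +
      C ^+ 2 * b i ^+ 2)); first by apply: eq_bigr => i _; ring.
  by rewrite big_split/= sumrB -!mulr_sumr -/A -/B -/C; ring.
by rewrite pmulr_rge0// subr_ge0.
Qed.

Lemma minkowski_sum n (a b : 'I_n -> R) :
  Num.sqrt (\sum_i (a i + b i) ^+ 2) <=
  Num.sqrt (\sum_i a i ^+ 2) + Num.sqrt (\sum_i b i ^+ 2).
Proof.
have sq0 (f : 'I_n -> R) : 0 <= \sum_i f i ^+ 2.
  by apply: sumr_ge0 => i _; exact: sqr_ge0.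
rewrite -[leRHS]ger0_norm ?addr_ge0 ?sqrtr_ge0// -sqrtr_sqr ler_wsqrtr//.
rewrite sqrrD !sqr_sqrtr//.
have -> : \sum_i (a i + b i) ^+ 2 =
    \sum_i a i ^+ 2 + (\sum_i a i * b i) *+ 2 + \sum_i b i ^+ 2.
  by rewrite -sumrMnl -!big_split/=; apply: eq_bigr => i _; rewrite sqrrD.
rewrite lerD2r lerD2l lerMn2r/= -sqrtrM//.
by rewrite (le_trans (ler_norm _))// -sqrtr_sqr ler_wsqrtr ?cauchy_schwarz_sum.
Qed.

Section euclidean.
Variable n : nat.
Implicit Types x y : 'cV[R[i]]_n.

Lemma vnorm2_ge0 x : 0 <= vnorm2 x.
Proof. exact: sqrtr_ge0. Qed.

(** Scalings, sign changes and diagonal matrices all act coordinatewise, so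
    this comparison covers the homogeneity properties of the norm at once. *)
Lemma vnorm2_le c x y : 0 <= c ->
  (forall i, cnorm (y i 0) <= c * cnorm (x i 0)) -> vnorm2 y <= c * vnorm2 x.
Proof.
move=> c0 yx; rewrite /vnorm2 -[in leRHS](ger0_norm c0) -sqrtr_sqr.
rewrite -sqrtrM ?sqr_ge0// ler_wsqrtr// mulr_sumr; apply: ler_sum => i _.
by rewrite -exprMn ler_pXn2r ?nnegrE ?mulr_ge0 ?cnorm_ge0.
Qed.

Lemma vnorm2Z_le (c : R[i]) x : vnorm2 (c *: x) <= cnorm c * vnorm2 x.
Proof.
by apply: vnorm2_le => [|i]; rewrite ?cnorm_ge0// mxE ComplexField.Normc.normcM.
Qed.

Lemma vnorm2D x y : vnorm2 (x + y) <= vnorm2 x + vnorm2 y.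
Proof.
apply: le_trans (minkowski_sum _ _); apply: ler_wsqrtr; apply: ler_sum => i _.
rewrite ler_pXn2r ?nnegrE ?addr_ge0 ?cnorm_ge0// mxE.
exact: le_normcD.
Qed.

Lemma vnorm2N_le x : vnorm2 (- x) <= vnorm2 x.
Proof.
by rewrite -[leRHS]mul1r; apply: vnorm2_le => // i; rewrite mxE normcN mul1r.
Qed.

Lemma vnorm2B x y : vnorm2 (x - y) <= vnorm2 x + vnorm2 y.
Proof.
by rewrite (le_trans (vnorm2D _ _))// lerD2l vnorm2N_le.
Qed.

Lemma cnorm_le_vnorm2 x i : cnorm (x i 0) <= vnorm2 x.
Proof.
rewrite -[leLHS]ger0_norm ?cnorm_ge0// -sqrtr_sqr ler_wsqrtr//.
by rewrite (bigD1 i)//= lerDl sumr_ge0// => j _; exact: sqr_ge0.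
Qed.

Lemma vnorm2_eq0 x : vnorm2 x = 0 -> x = 0.
Proof.
move=> x0; apply/colP => i; rewrite mxE; apply: ComplexField.Normc.eq0_normc.
by apply/eqP; rewrite eq_le cnorm_ge0 -x0 cnorm_le_vnorm2.
Qed.

Lemma vnorm20 : vnorm2 (0 : 'cV[R[i]]_n) = 0.
Proof.
rewrite /vnorm2 big1 ?sqrtr0// => i _.
by rewrite mxE ComplexField.Normc.normc0 expr0n.
Qed.

Lemma vnorm2_sum (I : finType) (f : I -> 'cV[R[i]]_n) :
  vnorm2 (\sum_i f i) <= \sum_i vnorm2 (f i).
Proof.
elim/big_rec2 : _ => [|i a y _ h]; first by rewrite vnorm20.
by rewrite (le_trans (vnorm2D _ _))// lerD2l.
Qed.

End euclidean.

Section spectral.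
Variables m n : nat.
Implicit Types (M : 'M[R[i]]_(m, n)) (x : 'cV[R[i]]_n).

(** A crude bound: it shows that the supremum defining the spectral norm is
    taken over a bounded set. *)
Lemma vnorm2_mulmx_le M x :
  vnorm2 (M *m x) <= (\sum_j vnorm2 (col j M)) * vnorm2 x.
Proof.
have -> : M *m x = \sum_j x j 0 *: col j M.
  apply/colP => i; rewrite mxE summxE; apply: eq_bigr => j _.
  by rewrite !mxE mulrC.
rewrite (le_trans (vnorm2_sum _))// mulr_suml; apply: ler_sum => j _.
rewrite (le_trans (vnorm2Z_le _ _))// mulrC ler_wpM2l ?vnorm2_ge0//.
exact: cnorm_le_vnorm2.
Qed.

Lemma mnorm2_ub M x : vnorm2 x <= 1 -> vnorm2 (M *m x) <= mnorm2 M.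
Proof.
move=> x1; apply: sup_upper_bound; last by exists x.
split; first by exists (vnorm2 (M *m x)); exists x.
exists (\sum_j vnorm2 (col j M)) => _ [y /= y1 <-].
rewrite (le_trans (vnorm2_mulmx_le _ _))//.
by rewrite ler_piMr// sumr_ge0// => j _; exact: vnorm2_ge0.
Qed.

Lemma mnorm2_ge0 M : 0 <= mnorm2 M.
Proof.
by rewrite (le_trans _ (@mnorm2_ub M 0 _)) ?vnorm2_ge0// vnorm20.
Qed.

Lemma mnorm2_mulmx M x : vnorm2 (M *m x) <= mnorm2 M * vnorm2 x.
Proof.
have [->|x0] := eqVneq x 0; first by rewrite mulmx0 !vnorm20 mulr0.
have nx0 : 0 < vnorm2 x.
  rewrite lt_def vnorm2_ge0 andbT; apply: contra x0 => /eqP/vnorm2_eq0 ->//.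
have normcR (r : R) : 0 <= r -> cnorm r%:C = r.
  by move=> r0; rewrite /= expr0n addr0 sqrtr_sqr ger0_norm.
set u := (vnorm2 x)^-1%:C *: x.
have u1 : vnorm2 u <= 1.
  by rewrite (le_trans (vnorm2Z_le _ _))// normcR ?mulVf ?gt_eqF// invr_ge0 ltW.
have -> : M *m x = (vnorm2 x)%:C *: (M *m u).
  rewrite -scalemxAr scalerA -rmorphM mulfV ?gt_eqF// rmorph1 scale1r//.
rewrite (le_trans (vnorm2Z_le _ _))// (normcR _ (ltW nx0)) [leRHS]mulrC.
by rewrite ler_wpM2l ?vnorm2_ge0// mnorm2_ub.
Qed.

End spectral.

Lemma cnorm_row_mul n (c : 'rV[R[i]]_n) (x : 'cV[R[i]]_n) :
  cnorm ((c *m x) 0 0) <= mnorm2 c * vnorm2 x.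
Proof. exact: le_trans (cnorm_le_vnorm2 _ _) (mnorm2_mulmx _ _). Qed.

End complex_norms.

(** * Perturbation of a linear system *)

Section resolvent_perturbation.
Variables (R : realType) (n : nat).
Implicit Types (K D : 'M[R[i]]_n) (b x y : 'cV[R[i]]_n) (c : 'rV[R[i]]_n).

Section small_perturbation.
Variables (K D : 'M[R[i]]_n) (delta : R).
Hypothesis K_unit : K \in unitmx.
Hypothesis D_le : forall x, vnorm2 (D *m x) <= delta * vnorm2 x.
Hypothesis delta_small : mnorm2 (invmx K) * delta <= 3 / 4.

(** Since [x = K^-1 ((K + D) x) - K^-1 (D x)] and the last term has norm at most
    [3/4 * vnorm2 x], a quarter of [vnorm2 x] is controlled by the first one. *)
Lemma perturbed_lower_bound x :
  vnorm2 x <= 4 * mnorm2 (invmx K) * vnorm2 ((K + D) *m x).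
Proof.
set k := mnorm2 (invmx K).
have xE : x = invmx K *m ((K + D) *m x) - invmx K *m (D *m x).
  by rewrite -mulmxBr -mulmxBl addrK mulKmx.
have h1 : vnorm2 x <= k * vnorm2 ((K + D) *m x) + k * (delta * vnorm2 x).
  rewrite {1}xE (le_trans (vnorm2B _ _))// lerD// (le_trans (mnorm2_mulmx _ _))//.
  by rewrite ler_wpM2l ?mnorm2_ge0.
have h2 : k * (delta * vnorm2 x) <= 3 / 4 * vnorm2 x.
  by rewrite mulrA ler_wpM2r ?vnorm2_ge0.
by lra.
Qed.

Lemma perturbed_unitmx : K + D \in unitmx.
Proof.
rewrite -unitmx_tr unitmxE unitfE; apply/negP => /det0P[v v0 vK].
suff : v^T = 0 by move/(congr1 trmx); rewrite trmxK trmx0; exact/eqP.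
apply: vnorm2_eq0; apply/eqP; rewrite eq_le vnorm2_ge0 andbT.
rewrite (le_trans (perturbed_lower_bound _))//.
by rewrite -[K + D]trmxK -trmx_mul vK trmx0 vnorm20 mulr0.
Qed.

(** The difference [e] of the two solutions solves the perturbed system
    [(K + D) e = (b' - b) - D (K^-1 b)]. *)
Lemma perturbed_solution b b' :
  vnorm2 (invmx (K + D) *m b' - invmx K *m b) <=
  4 * mnorm2 (invmx K) * (vnorm2 (b' - b) + delta * vnorm2 (invmx K *m b)).
Proof.
set x := invmx K *m b.
rewrite (le_trans (perturbed_lower_bound _))//.
rewrite ler_wpM2l ?mulr_ge0 ?mnorm2_ge0//.
have -> : (K + D) *m (invmx (K + D) *m b' - x) = b' - b - D *m x.
  rewrite mulmxBr mulKVmx ?perturbed_unitmx// mulmxDl mulKVmx//.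
  by rewrite opprD addrA.
by rewrite (le_trans (vnorm2B _ _))// lerD2l.
Qed.

End small_perturbation.

(** With [x = K^-1 b] and [e] the change of the solution, the change of the
    output is [c (e + V e + V x)], so that the norm of [c] enters only as a
    common factor. *)
Lemma noisy_output_perturbation c (V : 'M[R[i]]_n) K D b b' (r delta beta : R) :
  K \in unitmx -> 0 <= r ->
  (forall x, vnorm2 (D *m x) <= delta * vnorm2 x) ->
  mnorm2 (invmx K) * delta <= 3 / 4 ->
  vnorm2 (b' - b) <= beta ->
  (forall x, vnorm2 (V *m x) <= r * vnorm2 x) ->
  cnorm (((c + c *m V) *m invmx (K + D) *m b' - c *m invmx K *m b) 0 0) <=
  mnorm2 c * ((1 + r) * (4 * mnorm2 (invmx K) *
    (beta + delta * vnorm2 (invmx K *m b))) + r * vnorm2 (invmx K *m b)).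
Proof.
move=> Ku r0 Dle small bb Vle.
set x := invmx K *m b; set e := invmx (K + D) *m b' - x.
have eE : vnorm2 e <= 4 * mnorm2 (invmx K) * (beta + delta * vnorm2 x).
  rewrite (le_trans (perturbed_solution Ku Dle small _ _))//.
  by rewrite ler_wpM2l ?mulr_ge0 ?mnorm2_ge0// lerD2r.
have -> : (c + c *m V) *m invmx (K + D) *m b' - c *m invmx K *m b =
    c *m (e + V *m e + V *m x).
  rewrite -!mulmxA -/x -addrA -mulmxDr subrK mulmxDr mulmxDl /e mulmxBr !mulmxA.
  by rewrite addrAC.
rewrite (le_trans (cnorm_row_mul _ _))// ler_wpM2l ?mnorm2_ge0//.
rewrite (le_trans (vnorm2D _ _))// lerD// mulrDl mul1r.
rewrite (le_trans (vnorm2D _ _))// lerD//.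
by rewrite (le_trans (Vle _))// ler_wpM2l.
Qed.

End resolvent_perturbation.

(** * Gaussian tails and the union bound *)

Section gaussian_tail.
Variable R : realType.
Local Notation mu := (@lebesgue_measure R).

(** Completing the square: [x^2 - (x - c)^2 = 2 c x - c^2], which is at least
    [c^2] as soon as [c^2 <= c x].  So beyond [c] (on the side away from [0])
    the centred density is dominated by a small multiple of the density centred
    at [c]. *)
Lemma normal_pdf_shift_le (c x : R) : c ^+ 2 <= c * x ->
  normal_pdf 0 1 x <= expR (- (c ^+ 2 / 2)) * normal_pdf c 1 x.
Proof.
move=> cx; rewrite !normal_pdfE// mulrCA ler_wpM2l ?normal_peak_ge0//.
rewrite /normal_fun subr0 -expRD ler_expR expr1n.
have -> : (1 *+ 2 : R) = 2 by [].
by rewrite !mulNr -opprD lerN2 -mulrDl ler_pM2r ?invr_gt0//; nra.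
Qed.

(** Integrating the comparison of densities over [A] leaves the total mass [1]
    of the normal law centred at [c].  The hypothesis on [A] is written so as
    to serve the right tail ([0 <= c]) and the left tail ([c <= 0]). *)
Lemma normal_tail (c : R) (A : set R) : measurable A ->
  (forall x, A x -> c ^+ 2 <= c * x) ->
  (normal_prob 0 1 A <= (expR (- (c ^+ 2 / 2)))%:E)%E.
Proof.
move=> mA Ac; rewrite /normal_prob.
have mpdf m : measurable_fun [set: R] (EFin \o normal_pdf m 1).
  by apply/measurable_EFinP; exact: measurable_normal_pdf.
have pdf0 m x : (0 <= (normal_pdf m 1 x : R)%:E)%E.
  by rewrite lee_fin normal_pdf_ge0.
apply: (@le_trans _ _ (\int[mu]_(x in A)
    ((expR (- (c ^+ 2 / 2)))%:E * (normal_pdf c 1 x)%:E))%E).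
  apply: ge0_le_integral => //.
  - by apply: measurable_funTS; exact: mpdf.
  - by apply: measurable_funTS; apply: measurable_funeM; exact: mpdf.
  - by move=> x Ax; rewrite -EFinM lee_fin normal_pdf_shift_le ?Ac.
rewrite ge0_integralZl_EFin ?expR_ge0//; last first.
  by apply: measurable_funTS; exact: mpdf.
rewrite -[leRHS]mule1 lee_wpmul2l ?lee_fin ?expR_ge0//.
rewrite -(integral_normal_pdf c 1); apply: ge0_subset_integral => //; exact: mpdf.
Qed.

Lemma normal_two_sided_tail (a : R) : 0 <= a ->
  (normal_prob 0 1 [set x | (a < `|x|)%R] <= (2 * expR (- (a ^+ 2 / 2)))%:E)%E.
Proof.
move=> a0.
have -> : [set x : R | (a < `|x|)%R] = `]a, +oo[ `|` `]-oo, (- a)[.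
  apply/seteqP; split=> x /=; rewrite !in_itv/= andbT ltr_normr ltrNr.
    by move=> /orP.
  by move=> h; apply/orP.
rewrite (le_trans (measureU2 _ _ _))//.
rewrite mulr_natl mulr2n EFinD leeD//.
  by apply: normal_tail => // x/=; rewrite in_itv/= andbT; nra.
by rewrite -(sqrrN a); apply: normal_tail => // x/=; rewrite in_itv/=; nra.
Qed.

End gaussian_tail.

Section union_bound.
Context d (T : measurableType d) (R : realType) (P : probability T R).

Lemma union_bound (I : finType) (A : I -> set T) (p : R) :
  (forall i, measurable (A i)) -> (forall i, (P (A i) <= p%:E)%E) ->
  (P (\big[setU/set0]_i A i) <= (#|I|%:R * p)%:E)%E.
Proof.
move=> mA Ap; suff /(_ (index_enum I)) : forall s : seq I,
    (P (\big[setU/set0]_(i <- s) A i) <= \sum_(i <- s) p%:E)%E.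
  by rewrite sumEFin sumr_const mulr_natl.
elim=> [|i s ih]; first by rewrite !big_nil measure0.
rewrite !big_cons (le_trans (measureU2 _ _ _)) ?leeD//.
- exact: bigsetU_measurable.
- exact: Ap.
Qed.

End union_bound.

(** * Measurability of rational functions of the noise *)

Section complex_measurability.
Context d (T : measurableType d) (R : realType).
Implicit Types f g : T -> R[i].

(** Borel measurability under the identification of the complex plane with
    [R * R]. *)
Definition cmeasurable f :=
  measurable_fun setT (fun t => complex.Re (f t)) /\
  measurable_fun setT (fun t => complex.Im (f t)).

Lemma cmeasurable_cst (c : R[i]) : cmeasurable (fun=> c).
Proof. by split; exact: measurable_cst. Qed.

Lemma cmeasurableD f g :
  cmeasurable f -> cmeasurable g ->
  cmeasurable (fun t => f t + g t).
Proof.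
move=> [fr fi] [gr gi].
split; [move: (measurable_funD fr gr)|move: (measurable_funD fi gi)].
all: by apply: eq_measurable_fun => t _ /=; case: (f t); case: (g t).
Qed.

Lemma cmeasurableM f g :
  cmeasurable f -> cmeasurable g ->
  cmeasurable (fun t => f t * g t).
Proof.
move=> [fr fi] [gr gi]; split.
- move: (measurable_funB (measurable_funM fr gr) (measurable_funM fi gi)).
  by apply: eq_measurable_fun => t _ /=; case: (f t); case: (g t).
- move: (measurable_funD (measurable_funM fr gi) (measurable_funM fi gr)).
  by apply: eq_measurable_fun => t _ /=; case: (f t); case: (g t).
Qed.

Lemma cmeasurableZ (c : R[i]) f : cmeasurable f -> cmeasurable (fun t => c * f t).
Proof. exact/cmeasurableM/cmeasurable_cst. Qed.

Lemma cmeasurableB f g :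
  cmeasurable f -> cmeasurable g ->
  cmeasurable (fun t => f t - g t).
Proof.
move=> mf mg; have := cmeasurableD mf (cmeasurableZ (-1) mg).
by under eq_fun do rewrite mulN1r.
Qed.

Lemma cmeasurable_sum (I : Type) (r : seq I) (Q : pred I) (F : I -> T -> R[i]) :
  (forall i, cmeasurable (F i)) ->
  cmeasurable (fun t => \sum_(i <- r | Q i) F i t).
Proof.
move=> mF; elim: r => [|i r ih].
  by under eq_fun do rewrite big_nil; exact: cmeasurable_cst.
under eq_fun do rewrite big_cons.
by case: (Q i) => //; exact: cmeasurableD.
Qed.

Lemma cmeasurable_prod (I : Type) (r : seq I) (Q : pred I) (F : I -> T -> R[i]) :
  (forall i, cmeasurable (F i)) ->
  cmeasurable (fun t => \prod_(i <- r | Q i) F i t).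
Proof.
move=> mF; elim: r => [|i r ih].
  by under eq_fun do rewrite big_nil; exact: cmeasurable_cst.
under eq_fun do rewrite big_cons.
by case: (Q i) => //; exact: cmeasurableM.
Qed.

Lemma measurable_cnorm f : cmeasurable f ->
  measurable_fun setT (fun t => cnorm (f t)).
Proof.
move=> [fr fi].
have := measurableT_comp (continuous_measurable_fun (@sqrt_continuous R))
  (measurable_funD (measurable_funX 2 fr) (measurable_funX 2 fi)).
by apply: eq_measurable_fun => t _ /=; case: (f t).
Qed.

Definition mxmeasurable m n (F : T -> 'M[R[i]]_(m, n)) :=
  forall i j, cmeasurable (fun t => F t i j).

Lemma mxmeasurable_mul m n p (F : T -> 'M[R[i]]_(m, n))
    (G : T -> 'M[R[i]]_(n, p)) :
  mxmeasurable F -> mxmeasurable G -> mxmeasurable (fun t => F t *m G t).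
Proof.
move=> mF mG i j; under eq_fun do rewrite mxE.
by apply: cmeasurable_sum => k; exact: cmeasurableM.
Qed.

Lemma cmeasurable_det n (F : T -> 'M[R[i]]_n) :
  mxmeasurable F -> cmeasurable (fun t => \det (F t)).
Proof.
move=> mF; apply: cmeasurable_sum => s; apply: cmeasurableZ.
by apply: cmeasurable_prod => i; exact: mF.
Qed.

Lemma mxmeasurable_adj n (F : T -> 'M[R[i]]_n) :
  mxmeasurable F -> mxmeasurable (fun t => \adj (F t)).
Proof.
move=> mF i j; under eq_fun do rewrite mxE.
apply: cmeasurableZ; apply: cmeasurable_det => k l.
by under eq_fun do rewrite !mxE; exact: mF.
Qed.

(** Off the poles Cramer's rule writes the transfer function as a quotient
    [q / D] of polynomials in the entries, with [D] the determinant, so the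
    error bound amounts to the inequality [|q - h D| <= b |D|] between
    measurable functions. *)
Lemma measurable_transfer_close n (K : T -> 'M[R[i]]_n) (B : T -> 'cV[R[i]]_n)
    (C : T -> 'rV[R[i]]_n) (h : R[i]) (b : R) :
  mxmeasurable K -> mxmeasurable B -> mxmeasurable C ->
  measurable [set t | K t \in unitmx /\
    cnorm ((C t *m invmx (K t) *m B t) 0 0 - h) <= b].
Proof.
move=> mK mB mC.
pose D t := \det (K t); pose q t := (C t *m \adj (K t) *m B t) 0 0.
have mD : cmeasurable D by exact: cmeasurable_det.
have mq : cmeasurable q.
  apply: mxmeasurable_mul => //; apply: mxmeasurable_mul => //.
  exact: mxmeasurable_adj.
have -> : [set t | K t \in unitmx /\
    cnorm ((C t *m invmx (K t) *m B t) 0 0 - h) <= b] =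
  [set t | (fun t => ~~ (cnorm (D t) == 0)) t] `&`
  [set t | (fun t => cnorm (q t - h * D t) <=
                     b * cnorm (D t)) t].
  apply/seteqP; suff E t : (K t \in unitmx /\
      cnorm ((C t *m invmx (K t) *m B t) 0 0 - h) <= b) <->
    (~~ (cnorm (D t) == 0) /\
     cnorm (q t - h * D t) <=
     b * cnorm (D t)) by split=> t /E.
  have [D0|D0] := eqVneq (cnorm (D t)) 0.
    split=> -[] //; rewrite unitmxE unitfE.
    by rewrite -/(D t) (ComplexField.Normc.eq0_normc D0) eqxx.
  have Dn0 : D t != 0.
    by apply: contra D0 => /eqP ->; rewrite ComplexField.Normc.normc0.
  have Ku : K t \in unitmx by rewrite unitmxE unitfE.
  have normD : 0 < cnorm (D t).
    by rewrite lt_def D0/=; case: (D t) => u v; exact: sqrtr_ge0.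
  have -> : (C t *m invmx (K t) *m B t) 0 0 - h = (q t - h * D t) / D t.
    rewrite /invmx Ku -scalemxAr -scalemxAl mxE -/(D t) -/(q t).
    by rewrite mulrBl mulfK// mulrC.
  rewrite ComplexField.Normc.normcM ComplexField.Normc.normcV.
  by rewrite ler_pdivrMr// Ku; split=> -[].
apply: measurableI; rewrite -[X in measurable X]setTI.
- have := measurable_neg (measurable_fun_eqr (measurable_cnorm mD)
    (measurable_cst (0 : R))).
  by move=> /(_ measurableT [set true]); apply.
- have mqD : cmeasurable (fun t => q t - h * D t).
    by apply/cmeasurableB => //; exact: cmeasurableZ.
  have := measurable_fun_ler (measurable_cnorm mqD)
    (measurable_funM (measurable_cst b) (measurable_cnorm mD)).
  by move=> /(_ measurableT [set true]); apply.
Qed.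

End complex_measurability.

(** * Probability that all noise variables are small *)

Section noise_probability.
Context d (T : measurableType d) (R : realType) (P : probability T R).

Lemma measurable_norm_gt (a : R) : measurable [set x : R | (a < `|x|)%R].
Proof.
rewrite -[X in measurable X]setTI.
have := measurable_fun_ltr (measurable_cst a) (@normr_measurable R setT).
by move=> /(_ measurableT [set true]); apply.
Qed.

Lemma cnorm_le_of_coords (r : R) (z : R[i]) : 0 <= r ->
  `|complex.Re z| <= r / Num.sqrt 2 -> `|complex.Im z| <= r / Num.sqrt 2 ->
  cnorm z <= r.
Proof.
case: z => x y /= r0 xr yr.
have half u : `|u| <= r / Num.sqrt 2 -> u ^+ 2 <= r ^+ 2 / 2.
  move=> ur; rewrite -real_normK ?num_real//.
  have -> : r ^+ 2 / 2 = (r / Num.sqrt 2) ^+ 2.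
    by rewrite exprMn exprVn sqr_sqrtr.
  by rewrite ler_pXn2r// nnegrE divr_ge0// sqrtr_ge0.
rewrite -[leRHS](ger0_norm r0) -sqrtr_sqr ler_wsqrtr//.
by rewrite [leRHS](splitr (r ^+ 2)) lerD ?half.
Qed.

(** The event that all noise variables are small contains the complement of a
    finite union of Gaussian tail events; concluding about a measurable
    superset [S] of it is the form in which the estimate is applied. *)
Lemma small_noise_probability (I : finType) (Z : I -> T -> R[i]) (r : R)
    (S : set T) :
  (forall i, complex_std_normal P (Z i)) -> 0 <= r -> measurable S ->
  [set t | forall i, cnorm (Z i t) <= r] `<=` S ->
  ((1 - 4 * #|I|%:R * expR (- (r ^+ 2 / 4)))%:E <= P S)%E.
Proof.
move=> ZN r0 mS rS.
pose X (k : I * bool) t :=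
  if k.2 then complex.Re (Z k.1 t) else complex.Im (Z k.1 t).
pose a := r / Num.sqrt 2.
have a0 : 0 <= a by rewrite divr_ge0// sqrtr_ge0.
have a2 : a ^+ 2 / 2 = r ^+ 2 / 4.
  by rewrite /a exprMn exprVn sqr_sqrtr// -mulrA -invfM -natrM.
pose A k := X k @^-1` [set x : R | (a < `|x|)%R].
have mX k : measurable_fun setT (X k).
  by case: k => i []; rewrite /X/=; case: (ZN i).
have mA k : measurable (A k).
  rewrite -[X in measurable X]setTI; apply: mX => //.
  exact: measurable_norm_gt.
have PA k : (P (A k) <= (2 * expR (- (r ^+ 2 / 4)))%:E)%E.
  rewrite -a2 (le_trans _ (normal_two_sided_tail a0))//.
  have mgt := measurable_norm_gt a.
  case: k @A mA => i b A mA; rewrite /A /X/=; case: (ZN i) => _ _ _ NRe NIm.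
  by case: b => /=; rewrite (NRe, NIm).
pose U := \big[setU/set0]_k A k.
have mU : measurable U by exact: bigsetU_measurable.
have US : ~` U `<=` S.
  move=> t Ut; apply: rS => i.
  have Xle b : `|X (i, b) t| <= a.
    rewrite leNgt; apply/negP => aX; apply: Ut.
    by rewrite /U -bigcup_seq; exists (i, b) => //=; rewrite mem_index_enum.
  by apply: cnorm_le_of_coords => //; [exact: (Xle true)|exact: (Xle false)].
apply: (@le_trans _ _ (P (~` U))); last first.
  by apply: le_measure => //; rewrite inE//; exact: measurableC.
rewrite probability_setC// EFinB leeB//.
rewrite (le_trans (union_bound mA PA))// lee_fin card_prod card_bool.
by rewrite natrM; lra.
Qed.

(** After division by [4 exp (- n / 2)] the claim is [2 n <= exp (7 n / 4)],
    which follows from [2 n <= 2 ^ n <= exp n]. *)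
Lemma gaussian_tail_budget (n : nat) :
  4 * (n + n)%:R * expR (- ((3 * Num.sqrt n%:R) ^+ 2 / 4)) <=
  4 * expR (- (n%:R / 2)) :> R.
Proof.
have n0 : (0 : R) <= n%:R by [].
rewrite exprMn sqr_sqrtr//.
have -> : - (3 ^+ 2 * n%:R / 4) = - (n%:R / 2) - n%:R * (7 / 4) :> R by lra.
rewrite expRD -mulrA ler_pM2l// mulrCA -[leRHS]mulr1 ler_pM2l ?expR_gt0//.
rewrite expRN ler_pdivrMr ?expR_gt0// mul1r.
apply: (@le_trans _ _ (2 ^+ n)).
  rewrite -natrX ler_nat; elim: n {n0} => // -[|n] ih //.
  by rewrite expnS addnn -mul2n leq_mul2l/= (leq_trans _ ih)// addSnnS leq_addl.
apply: (@le_trans _ _ (expR 1 ^+ n)).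
  by rewrite lerXn2r ?nnegrE ?expR_ge0// (le_trans _ (expR_ge1Dx 1)).
by rewrite -expRM_natl ler_expR; lra.
Qed.

End noise_probability.

(** * The noisy Loewner pencil *)

Section loewner_noise.
Variables (R : realType) (n : nat).
Implicit Types e f : 'I_n -> R[i].

Definition noise_mx (sigma : R) e : 'M[R[i]]_n :=
  diag_mx (\row_i (sigma%:C * e i)).

Lemma noise_mx_le sigma e (r : R) (x : 'cV[R[i]]_n) : 0 <= sigma ->
  (forall i, cnorm (e i) <= r) -> 0 <= r ->
  vnorm2 (noise_mx sigma e *m x) <= sigma * r * vnorm2 x.
Proof.
move=> s0 er r0; apply: vnorm2_le => [|i]; first by rewrite mulr_ge0.
rewrite mul_diag_mx !mxE !ComplexField.Normc.normcM.
rewrite ler_wpM2r ?cnorm_ge0//.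
by rewrite /= expr0n addr0 sqrtr_sqr ger0_norm// ler_wpM2l.
Qed.

Variables mu gam hmu hgam : 'I_n -> R[i].
Hypothesis mu_neq_gam : forall i j, mu i != gam j.

(** The noise on [hmu i] affects row [i] of the pencil and the noise on
    [hgam j] affects column [j], hence a left and a right diagonal factor. *)
Lemma loewner_pencil_noise s sigma e f :
  let pencil h h' := s *: loewner_E mu gam h h' - loewner_A mu gam h h' in
  pencil (noisy hmu sigma e) (noisy hgam sigma f) =
  pencil hmu hgam + (noise_mx sigma e *m F_E mu gam hmu s +
                     F_A mu gam hgam s *m noise_mx sigma f).
Proof.
apply/matrixP => i j; rewrite mul_diag_mx mul_mx_diag !mxE /noisy.
have mg : mu i - gam j != 0 by rewrite subr_eq0.
have gm : gam j - mu i != 0 by rewrite subr_eq0 eq_sym.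
field; by rewrite mg gm.
Qed.

Lemma loewner_B_noise sigma e :
  loewner_B (noisy hmu sigma e) - loewner_B hmu =
  noise_mx sigma e *m loewner_B hmu.
Proof.
by apply/colP => i; rewrite mul_diag_mx !mxE /noisy; ring.
Qed.

Lemma loewner_C_noise sigma f :
  loewner_C (noisy hgam sigma f) =
  loewner_C hgam + loewner_C hgam *m noise_mx sigma f.
Proof.
by apply/rowP => j; rewrite mul_mx_diag !mxE /noisy; ring.
Qed.

Lemma pencil_noise_le s sigma e f r (x : 'cV[R[i]]_n) : 0 <= sigma -> 0 <= r ->
  (forall i, cnorm (e i) <= r) -> (forall j, cnorm (f j) <= r) ->
  vnorm2 ((noise_mx sigma e *m F_E mu gam hmu s +
           F_A mu gam hgam s *m noise_mx sigma f) *m x) <=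
  sigma * r * (mnorm2 (F_E mu gam hmu s) + mnorm2 (F_A mu gam hgam s)) *
  vnorm2 x.
Proof.
move=> s0 r0 er fr; have sr0 : 0 <= sigma * r by rewrite mulr_ge0.
rewrite mulmxDl (le_trans (vnorm2D _ _))// mulrDr mulrDl lerD// -!mulmxA.
  rewrite (le_trans (noise_mx_le _ s0 er r0))// -[leRHS]mulrA ler_wpM2l//.
  exact: mnorm2_mulmx.
rewrite (le_trans (mnorm2_mulmx _ _))// [leRHS]mulrAC [leRHS]mulrC.
rewrite ler_wpM2l ?mnorm2_ge0//.
exact: noise_mx_le.
Qed.

(** The bound depends on [sigma] through an overall factor [sigma] and through
    [1 + sigma * r], which stays bounded below the noise threshold. *)
Lemma noisy_loewner_transfer s sigma e f r :
  let K := s *: loewner_E mu gam hmu hgam - loewner_A mu gam hmu hgam in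
  let F := mnorm2 (F_E mu gam hmu s) + mnorm2 (F_A mu gam hgam s) in
  let k := mnorm2 (invmx K) in
  let x := vnorm2 (invmx K *m loewner_B hmu) in
  let nmu := noisy hmu sigma e in
  let ngam := noisy hgam sigma f in
  K \in unitmx -> 0 <= sigma -> 0 <= r ->
  (forall i, cnorm (e i) <= r) -> (forall j, cnorm (f j) <= r) ->
  k * (sigma * r * F) <= 3 / 4 ->
  ~~ pole (loewner_E mu gam nmu ngam) (loewner_A mu gam nmu ngam) s /\
  cnorm (loewner_transfer mu gam nmu ngam s -
         loewner_transfer mu gam hmu hgam s) <=
  mnorm2 (loewner_C hgam) * ((1 + sigma * r) * (4 * k *
    (sigma * r * vnorm2 (loewner_B hmu) + sigma * r * F * x)) + sigma * r * x).
Proof.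
move=> K F k x nmu ngam Ku s0 r0 er fr small.
rewrite /pole /loewner_transfer /transfer !loewner_pencil_noise -/K.
have Dle y := pencil_noise_le s y s0 r0 er fr.
split; first by rewrite negbK (perturbed_unitmx Ku Dle).
rewrite loewner_C_noise.
have -> (u v : 'M[R[i]]_1) : u 0 0 - v 0 0 = (u - v) 0 0 by rewrite !mxE.
apply: noisy_output_perturbation => //; first by rewrite mulr_ge0.
  by rewrite loewner_B_noise noise_mx_le.
by move=> y; rewrite noise_mx_le.
Qed.

End loewner_noise.

(** The condition number cancels [mnorm2 K], leaving
    [mnorm2 (invmx K) * (4 sqrt n) * F * sigma <= 1]; noise of size [3 sqrt n]
    instead of [4 sqrt n] then leaves a margin of a quarter.  If a denominator
    vanishes, so does the quotient, and no positive [sigma] is admissible. *)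
Lemma threshold_gap (R : realType) (n : nat) (K : 'M[R[i]]_n) (F v sigma : R) :
  0 <= F -> 0 < sigma ->
  sigma < (cond2 K)^-1 * Num.min (mnorm2 K / (4 * Num.sqrt n%:R * F)) v ->
  mnorm2 (invmx K) * (sigma * (3 * Num.sqrt n%:R) * F) <= 3 / 4.
Proof.
rewrite /cond2; set a := mnorm2 K; set k := mnorm2 (invmx K) => F0 s0 sub.
have a0 : 0 <= a by exact: mnorm2_ge0.
have k0 : 0 <= k by exact: mnorm2_ge0.
have q0 : 0 <= 4 * Num.sqrt n%:R * F by rewrite !mulr_ge0 ?sqrtr_ge0.
suff : k * (4 * Num.sqrt n%:R * F) * sigma <= 1 by lra.
set q := 4 * Num.sqrt n%:R * F in q0 sub *.
have {}sub : sigma < (a * k)^-1 * (a / q).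
  by rewrite (lt_le_trans sub)// ler_wpM2l ?invr_ge0 ?mulr_ge0// ge_min lexx.
have : 0 < (a * k)^-1 * (a / q) by exact: lt_trans sub.
have [->|an] := eqVneq a 0; first by rewrite !mul0r mulr0 ltxx.
have [->|kn] := eqVneq k 0; first by rewrite !mul0r ler01.
have [->|qn] := eqVneq q 0; first by rewrite mulr0 mul0r ler01.
have kq : 0 < k * q by rewrite lt_def mulf_neq0// mulr_ge0.
move=> _; rewrite mulrC -ler_pdivlMr// (le_trans (ltW sub))// le_eqVlt.
by apply/orP; left; apply/eqP; field; rewrite an kn qn.
Qed.

(** * The error bound in probability *)

Theorem theorem1 (R : realType)
    (N : nat) (E A : 'M[R]_N) (B : 'cV[R]_N) (C : 'rV[R]_N)
    (rankE : \rank E = N)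
    (n : nat) (mu gam : 'I_n -> R[i])
    (mu_neq_gam : forall i j, mu i != gam j)
    (H_def_mu : forall i, ~~ real_pole E A (mu i))
    (H_def_gam : forall j, ~~ real_pole E A (gam j))
    (d : measure_display) (T : measurableType d) (P : probability T R)
    (eps eta : 'I_n -> T -> R[i])
    (eps_normal : forall i, complex_std_normal P (eps i))
    (eta_normal : forall j, complex_std_normal P (eta j))
    (eps_eta_indep : complex_independent P
       (fun k : 'I_n + 'I_n =>
          match k with inl i => eps i | inr j => eta j end)) :
  let H := real_transfer E A B C in
  let hmu := fun i => H (mu i) in
  let hgam := fun j => H (gam j) in
  let hE := loewner_E mu gam hmu hgam in
  let hA := loewner_A mu gam hmu hgam in
  let hB := loewner_B hmu in
  let nmu := fun sigma t => noisy hmu sigma (fun i => eps i t) in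
  let ngam := fun sigma t => noisy hgam sigma (fun j => eta j t) in
  let tE := fun sigma t => loewner_E mu gam (nmu sigma t) (ngam sigma t) in
  let tA := fun sigma t => loewner_A mu gam (nmu sigma t) (ngam sigma t) in
  let bounded := fun (sigma : R) (s : R[i]) (b : R) => [set t |
    ~~ pole (tE sigma t) (tA sigma t) s /\
    ComplexField.Normc.normc
      (loewner_transfer mu gam (nmu sigma t) (ngam sigma t) s -
       loewner_transfer mu gam hmu hgam s) <= b] in
  hB != 0 ->
  forall Omega : set R[i],
  (forall s, Omega s -> ~~ pole hE hA s) ->
  forall s, Omega s ->
  exists2 Cs : R, 0 < Cs &
  forall sigma : R,
    0 < sigma ->
    sigma < (cond2 (s *: hE - hA))^-1 *
      Num.min
        (mnorm2 (s *: hE - hA) /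
           (4 * Num.sqrt n%:R *
              (mnorm2 (F_E mu gam hmu s) + mnorm2 (F_A mu gam hgam s))))
        (vnorm2 hB / (4 * Num.sqrt n%:R * vnorm_inf hB)) ->
    ((1 - 4 * expR (- (n%:R / 2)))%:E <= P (bounded sigma s (Cs * sigma)%R))%E.
Proof.
move=> H hmu hgam hE hA hB nmu ngam tE tA bounded _ Omega noPole s /noPole Ku.
set K := s *: hE - hA in Ku *; rewrite /pole negbK -/K in Ku.
set F := mnorm2 (F_E mu gam hmu s) + mnorm2 (F_A mu gam hgam s).
set v := vnorm2 hB / _.
set sigma0 := (cond2 K)^-1 * _.
pose k := mnorm2 (invmx K).
pose x := vnorm2 (invmx K *m hB).
pose c := mnorm2 (loewner_C hgam).
pose r : R := 3 * Num.sqrt n%:R.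
have F0 : 0 <= F by rewrite addr_ge0 ?mnorm2_ge0.
have k0 : 0 <= k by exact: mnorm2_ge0.
have c0 : 0 <= c by exact: mnorm2_ge0.
have x0 : 0 <= x by exact: vnorm2_ge0.
have b0 : 0 <= vnorm2 hB by exact: vnorm2_ge0.
have r0 : 0 <= r by rewrite mulr_ge0 ?sqrtr_ge0.
pose g := 4 * k * (r * vnorm2 hB + r * F * x).
have g0 : 0 <= g.
  by apply: mulr_ge0; [exact: mulr_ge0|apply: addr_ge0; rewrite !mulr_ge0].
(* The summand [1] makes the constant positive. *)
exists (1 + c * ((1 + `|sigma0| * r) * g + r * x)).
  rewrite ltr_pwDl// mulr_ge0// addr_ge0//; last exact: mulr_ge0.
  by rewrite mulr_ge0// addr_ge0// mulr_ge0.
move=> sigma sigma_gt0 sigma_lt.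
have small : k * (sigma * r * F) <= 3 / 4 := threshold_gap F0 sigma_gt0 sigma_lt.
pose Z (k : 'I_n + 'I_n) := match k with inl i => eps i | inr j => eta j end.
apply: le_trans (small_noise_probability (Z := Z) _ r0 _ _).
- by rewrite lee_fin lerD2l lerN2 card_sum card_ord gaussian_tail_budget.
- by case=> i; [exact: eps_normal|exact: eta_normal].
- have mN (h : 'I_n -> R[i]) (e : 'I_n -> T -> R[i]) i :
      complex_std_normal P (e i) ->
      cmeasurable (fun t => noisy h sigma (fun j => e j t) i).
    move=> -[mRe mIm _ _ _]; apply: cmeasurableZ; apply: cmeasurableD.
      exact: cmeasurable_cst.
    by apply: cmeasurableZ; split.
  have mmu i : cmeasurable (fun t => nmu sigma t i) by exact: mN.
  have mgam j : cmeasurable (fun t => ngam sigma t j) by exact: mN.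
  rewrite /bounded /pole; under eq_set do rewrite negbK.
  apply: measurable_transfer_close => i j.
  + have entryE t : (s *: tE sigma t - tA sigma t) i j =
        (mu i - s) / (mu i - gam j) * nmu sigma t i -
        (gam j - s) / (mu i - gam j) * ngam sigma t j.
      by rewrite !mxE; ring.
    under eq_fun do rewrite entryE.
    by apply: cmeasurableB; apply: cmeasurableZ.
  + by under eq_fun do rewrite mxE; exact: mmu.
  + by under eq_fun do rewrite mxE; exact: mgam.
move=> t noise_le; rewrite /bounded/=.
have [] := noisy_loewner_transfer mu_neq_gam Ku (ltW sigma_gt0) r0
  (fun i => noise_le (inl i)) (fun j => noise_le (inr j)) small.
move=> nopole err; split=> //; apply: le_trans err _.
rewrite -/c -/k -/x.
have -> : 4 * k * (sigma * r * vnorm2 hB + sigma * r * F * x) = sigma * g.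
  by rewrite /g; ring.
have sigma_le : 1 + sigma * r <= 1 + `|sigma0| * r.
  by rewrite lerD2l ler_wpM2r// (le_trans (ltW sigma_lt))// ler_norm.
rewrite [leRHS]mulrC [leRHS]mulrDr mulr1.
have -> : c * ((1 + sigma * r) * (sigma * g) + sigma * r * x) =
  sigma * (c * ((1 + sigma * r) * g + r * x)) by ring.
apply: ler_wpDl; first exact: ltW.
by rewrite ler_wpM2l ?(ltW sigma_gt0)// ler_wpM2l// lerD2r ler_wpM2r.
Qed.
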